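(* Let $G$ be a triangle-free graph with $n$ vertices and average degree $t$. Then \[ i(G) \geq \max\left\{e^{(1-n^{-1/12})\frac{1}{2}\frac{n}{t}\ln t \left(\frac{1}{2}\ln t-1\right)},\ 2^t\right\}. \] Consequently, for every triangle-free graph $H$ on $n$ vertices, \[ i(H) \geq e^{(1-o(1)) \frac{\sqrt{n\ln 2}\,\ln n}{4}}, \] where $o(1)$ denotes a quantity tending to $0$ as $n\to\infty$ (uniformly over all triangle-free graphs on $n$ vertices).
   Context: For a graph $G$, $i(G)$ denotes the number of independent sets in $G$ (sets of vertices no two of which are adjacent, including the empty set). The average degree of a graph with $n$ vertices and $m$ edges is $2m/n$. All logarithms are natural logarithms.
   Formalization: The exponential lower bound in the maximum is stated only for average degree t ≥ 1, since it is undefined at t = 0 and false for small t (for example n = 10 with one edge); the bound 2^t and the asymptotic bound are stated for all triangle-free graphs. *)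

(* Defs.v *)
From HB Require Import structures.
From mathcomp Require Import all_boot all_order all_algebra.
From mathcomp Require Import all_classical all_reals all_analysis.
Set Implicit Arguments.
Unset Strict Implicit.
Unset Printing Implicit Defensive.
Import Order.TTheory GRing.Theory Num.Theory.
Local Open Scope ring_scope.

Record sgraph := SGraph {
  vertex :> finType;
  adj : rel vertex;
  adj_sym : symmetric adj;
  adj_irr : irreflexive adj }.

Definition edges (G : sgraph) : {set {set G}} :=
  [set [set x; y] | x in [set: G], y in [set: G] & adj x y].

Definition avg_degree (R : realType) (G : sgraph) : R :=
  2 * #|edges G|%:R / #|G|%:R.

Definition triangle_free (G : sgraph) : Prop :=
  forall x y z : G, ~ [/\ adj x y, adj y z & adj x z].

Definition independent (G : sgraph) (S : {set G}) : bool :=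
  [forall x in S, forall y in S, ~~ adj x y].

Definition num_indep (G : sgraph) : nat := #|[set S : {set G} | independent S]|.

(* Main.v *)
Require Import Defs.
From HB Require Import structures.
From mathcomp Require Import all_boot all_order all_algebra.
From mathcomp Require Import all_classical all_reals all_analysis.
From mathcomp Require Import ring lra.
Set Implicit Arguments.
Unset Strict Implicit.
Import Order.TTheory GRing.Theory Num.Theory.
Import numFieldNormedType.Exports.
Local Open Scope classical_set_scope.
Local Open Scope ring_scope.

(** Deleting a vertex v, or v together with its neighbours, gives
    i(G) >= i(G - v) + i(G - N[v]).  By induction this yields
    ln i(G) >= n phi(t) for a convex decreasing phi with
    phi(t) = (ln t)^2 / (4 t) for t >= e^3, continued below e^3 by its tangent
    line.  Convexity replaces phi by its tangent at the average degree t of G, so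
    that only the numbers of vertices and edges of the two smaller graphs matter;
    triangle-freeness makes the edge loss in the second one the sum of the degrees
    of the neighbours of v.  Averaging over v with Jensen's inequality for exp and
    the Cauchy-Schwarz inequality for degrees leaves a one-variable inequality.
    The factor 1 - n^(-1/12) is thus not lost, and the term 2^t comes from the
    subsets of the neighbourhood of a vertex of maximal degree.  For the second
    part, the two bounds cross near T = sqrt(n ln 2) ln n / (4 ln 2) >= sqrt n,
    where phi already gives the claim with o(1) = 0 for large n. *)

(** * Tangents to [(ln t) ^+ 2 / (4 * t)] and the one-variable inequalities *)

Section TangentLines.
Context {R : realType}.
Implicit Types t u v x : R.

(* [line t u] is the value at [t] of the tangent at [expR u] to the function
   [(ln t) ^+ 2 / (4 * t)], which is convex for [t >= expR 3]. *)
Definition line_cst u : R := (u ^+ 2 - u) / 2 * expR (- u).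

Definition line_slope u : R := (2 * u - u ^+ 2) / 4 * expR (- u) ^+ 2.

Definition line t u : R := line_cst u + t * line_slope u.

Lemma line_slope_le0 u : 2 <= u -> line_slope u <= 0.
Proof.
move=> u2; apply: mulr_le0_ge0; last exact: exprn_ge0 (expR_ge0 _).
by nra.
Qed.

(** For [f t = (ln t) ^+ 2 / (4 * t)] this derivative is [(t - expR x) * f'' (expR x) * expR x], the
    rate at which the tangent's value at [t] changes as the point of tangency moves. *)
Lemma is_derive_line t x :
  is_derive x 1 (line t)
    ((t * expR (- x) - 1) * ((x ^+ 2 - 3 * x + 1) / 2 * expR (- x))).
Proof.
pose e : R -> R := fun u => expR (- u).
have de : is_derive x 1 e (- e x).
  have -> : - e x = expR (- x) * -1 by rewrite /e; ring.
  exact: (@is_derive1_comp _ expR -%R).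
have -> : line t = (id ^+ 2 - id) * cst 2^-1 * e
                   + (cst 2 * id - id ^+ 2) * cst (t / 4) * e ^+ 2.
  by apply/funext => u; rewrite /line /line_cst /line_slope !fctE -/(e u); field.
rewrite -/(e x); move: e de => e de; apply: is_derive_eq.
by rewrite !fctE /GRing.scale /=; field.
Qed.

Lemma MVT_line t a b : a < b -> exists2 c, a < c < b &
  line t b - line t a =
  (t * expR (- c) - 1) * ((c ^+ 2 - 3 * c + 1) / 2 * expR (- c)) * (b - a).
Proof.
move=> ab.
have [|c] := MVT ab (fun x _ => is_derive_line t x).
  apply: continuous_subspaceT => x; apply: differentiable_continuous.
  by apply/derivable1_diffP; have [] := is_derive_line t x.
by rewrite in_itv /=; exists c.
Qed.

(** The derivative in [u] has the sign of [t - expR u], since [u ^+ 2 - 3 * u + 1 > 0] for [u >= 3].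
    The last hypothesis encodes that [v] is the maximum of [3] and [ln t]. *)
Lemma le_line_max t u v : 3 <= v -> 3 <= u ->
  (v == 3) && (t <= expR 3) || (t == expR v) -> line t u <= line t v.
Proof.
move=> v3 u3 tv.
have pos (c : R) : 3 < c -> 0 <= (c ^+ 2 - 3 * c + 1) / 2 * expR (- c).
  by move=> c3; apply: mulr_ge0 (expR_ge0 _); nra.
have [uv|vu|-> //] := ltgtP u v.
  have [c /andP[uc cv] eqc] := MVT_line t uv.
  have c3 : 3 < c by apply: le_lt_trans uc.
  rewrite -subr_ge0 eqc; apply: mulr_ge0; last by rewrite subr_ge0 ltW.
  apply: mulr_ge0 (pos _ c3).
  case/orP: tv => [/andP[/eqP v_eq _]|/eqP ->]; first by lra.
  by rewrite -expRD subr_ge0 -expR0 ler_expR; lra.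
have [c /andP[vc cu] eqc] := MVT_line t vu.
have c3 : 3 < c by apply: le_lt_trans vc.
rewrite -subr_le0 eqc; apply: mulr_le0_ge0; last by rewrite subr_ge0 ltW.
apply: mulr_le0_ge0 (pos _ c3).
have tv' : t <= expR v by case/orP: tv => [/andP[/eqP ->]|/eqP ->].
rewrite subr_le0; apply: (@le_trans _ _ (expR v * expR (- c))).
  by rewrite ler_pM2r ?expR_gt0.
by rewrite -expRD -expR0 ler_expR; lra.
Qed.

Lemma line_expR u : line (expR u) u = u ^+ 2 / 4 / expR u.
Proof.
have eu0 : expR u != 0 by rewrite gt_eqF ?expR_gt0.
by rewrite /line /line_cst /line_slope expRN; field.
Qed.

Lemma expR3_ge16 : 16 <= expR 3 :> R.
Proof.
(* [1 + x <= expR x] at [x = 1 / 8], raised to the power 24 by repeated squaring with rounding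
   down. *)
have -> : 3 = 24%:R * (1 / 8) :> R by field.
rewrite expRM_natl; have := expR_ge1Dx (1 / 8 : R); set z := expR _ => z1.
have z2 : 1265 / 1000 <= z ^+ 2 by nra.
have z4 : 16 / 10 <= z ^+ 4 by rewrite (exprM z 2 2); nra.
have z8 : 256 / 100 <= z ^+ 8 by rewrite (exprM z 4 2); nra.
have z16 : 65 / 10 <= z ^+ 16 by rewrite (exprM z 8 2); nra.
have -> : z ^+ 24 = z ^+ 8 * z ^+ 16 by rewrite -exprD.
by nra.
Qed.

(** The two terms are the factors by which the bound changes when a vertex, or a closed
    neighbourhood, is deleted: the vertex count drops by [1] or [1 + t], the degree sum by [2 * t]
    or [2 * t ^+ 2]. They are at least [1 - 3 * E] and [3 * E]. *)
Lemma expR_step_small t : 0 <= t <= expR 3 ->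
  1 <= expR (- line_cst 3 - 2 * t * line_slope 3)
       + expR (- (1 + t) * line_cst 3 - 2 * t ^+ 2 * line_slope 3).
Proof.
move=> /andP[t0 t3]; rewrite /line_cst /line_slope.
set E := expR (- 3); have E0 : 0 < E by exact: expR_gt0.
have e3 : expR 3 * E = 1 by exact: expRxMexpNx_1.
have E16 : E <= 1 / 16 by have := expR3_ge16; nra.
pose y := t * E; have y0 : 0 <= y by apply: mulr_ge0 => //; apply: ltW.
have y1 : y <= 1 by rewrite -e3 ler_pM2r.
have -> : - ((3 ^+ 2 - 3) / 2 * E) - 2 * t * ((2 * 3 - 3 ^+ 2) / 4 * E ^+ 2)
  = - 3 * E + 3 / 2 * y * E by rewrite /y; field.
have -> : - (1 + t) * ((3 ^+ 2 - 3) / 2 * E)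
  - 2 * t ^+ 2 * ((2 * 3 - 3 ^+ 2) / 4 * E ^+ 2)
  = - 3 * E - 3 * y + 3 / 2 * y ^+ 2 by rewrite /y; field.
have h1 : 1 - 3 * E <= expR (- 3 * E + 3 / 2 * y * E).
  apply: le_trans (expR_ge1Dx _); have := mulr_ge0 y0 (ltW E0); nra.
have h2 : 3 * E <= expR (- 3 * E - 3 * y + 3 / 2 * y ^+ 2).
  (* The exponent is least at [y = 1], hence at least [- 3 / 16 - 3 / 2 = 6 * (21 / 96) - 3]. *)
  apply: (@le_trans _ _ (expR (6%:R * (21 / 96)) * E)).
    rewrite ler_pM2r // expRM_natl; have := expR_ge1Dx (21 / 96 : R).
    set z := expR _ => z1.
    have z2 : 148 / 100 <= z ^+ 2 by nra.
    have z4 : 2 <= z ^+ 4 by rewrite (exprM z 2 2); nra.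
    have -> : z ^+ 6 = z ^+ 2 * z ^+ 4 by rewrite -exprD.
    by nra.
  by rewrite -expRD ler_expR; nra.
by lra.
Qed.

(** At the point of tangency [t = expR u] the exponents collapse to [- (u / 2 * E)] and
    [u / 2 - A - u]. As [A <= 1], the bound [1 + x <= expR x] makes the terms at least
    [1 - u / 2 * E] and [u / 2 * E]. *)
Lemma expR_step_large u : 3 <= u ->
  1 <= expR (- line_cst u - 2 * expR u * line_slope u)
       + expR (- (1 + expR u) * line_cst u - 2 * expR u ^+ 2 * line_slope u).
Proof.
move=> u3; rewrite /line_cst /line_slope.
have eu := expRxMexpNx_1 u.
set E := expR (- u) in eu *; set t := expR u in eu *.
have E0 : 0 < E by exact: expR_gt0.
pose A := (u ^+ 2 - u) / 2 * E.
have -> : - ((u ^+ 2 - u) / 2 * E) - 2 * t * ((2 * u - u ^+ 2) / 4 * E ^+ 2)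
  = - (u / 2 * E).
  transitivity (- ((u ^+ 2 - u) / 2 * E) - (2 * u - u ^+ 2) / 2 * (t * E) * E).
    by field.
  by rewrite eu; field.
have -> : - (1 + t) * ((u ^+ 2 - u) / 2 * E)
  - 2 * t ^+ 2 * ((2 * u - u ^+ 2) / 4 * E ^+ 2) = (u / 2 - A) + (- u).
  transitivity (- A - (u ^+ 2 - u) / 2 * (t * E)
    - (2 * u - u ^+ 2) / 2 * (t * E) ^+ 2); first by rewrite /A; field.
  by rewrite eu; field.
have A1 : A <= 1.
  rewrite -eu ler_pM2r //; have := @expR_ge1Dxn _ u 1; rewrite -/t.
  by move=> /(_ ltac:(lra)); rewrite (_ : 2`!%:R = 2 :> R) //; lra.
have h1 := expR_ge1Dx (- (u / 2 * E)).
have h2 : u / 2 * E <= expR (u / 2 - A + - u).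
  rewrite expRD ler_pM2r //; apply: le_trans (expR_ge1Dx _); lra.
by lra.
Qed.

Lemma max_line t : 0 <= t -> exists v, [/\ 3 <= v,
  forall u, 3 <= u -> line t u <= line t v &
  1 <= expR (- line_cst v - 2 * t * line_slope v)
       + expR (- (1 + t) * line_cst v - 2 * t ^+ 2 * line_slope v)].
Proof.
move=> t0; have [t3|t3] := leP t (expR 3).
  exists 3; split => // [u u3|]; last by apply: expR_step_small; rewrite t0.
  by apply: le_line_max; rewrite ?eqxx ?t3.
have lt : t = expR (ln t) by rewrite lnK // posrE (lt_trans _ t3) ?expR_gt0.
have l3 : 3 <= ln t by rewrite -ler_expR -lt ltW.
exists (ln t); split => // [u u3|].
  by apply: le_line_max; rewrite // -lt eqxx orbT.
by have := expR_step_large l3; rewrite -lt.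
Qed.

(** Jensen's inequality: [expR] lies above its tangent at [m]. *)
Lemma sum_expR_ge (I : finType) (S : {set I}) (f : I -> R) m :
  m * #|S|%:R <= \sum_(i in S) f i ->
  #|S|%:R * expR m <= \sum_(i in S) expR (f i).
Proof.
move=> le_m; apply: (@le_trans _ _ (\sum_(i in S) expR m * (1 + (f i - m)))).
  rewrite -mulr_sumr mulrC ler_pM2l ?expR_gt0 //.
  by rewrite big_split /= sumrB !sumr_const -(mulr_natr m); lra.
apply: ler_sum => i _; rewrite -[in leRHS](subrKC m (f i)) expRD.
by rewrite ler_pM2l ?expR_gt0 // expR_ge1Dx.
Qed.

End TangentLines.

(** * Degrees and independent sets in induced subgraphs *)

Section InducedSubgraphs.
Import fintype boot.finset.
Local Open Scope nat_scope.
Context {G : sgraph}.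
Implicit Types (S D I : {set G}) (v x y : G).

(** An induced subgraph is represented by its vertex set [S], so that the induction stays inside one
    graph [G]. *)
Definition nbrs S v : {set G} := [set y in S | adj v y].

Definition degree S v : nat := #|nbrs S v|.

Definition degree_sum S : nat := \sum_(v in S) degree S v.

Definition num_indep_in S : nat :=
  #|[set I : {set G} | (I \subset S) && independent I]|.

Lemma num_indep_inT : num_indep_in [set: G] = num_indep G.
Proof. by apply: eq_card => I; rewrite !inE subsetT. Qed.

Lemma independentP I :
  reflect {in I &, forall x y, ~~ adj x y} (independent I).
Proof.
apply: (iffP forall_inP) => [h x y xI yI|h x xI].
  exact: (forall_inP (h x xI)).
by apply/forall_inP => y yI; exact: h.
Qed.

Lemma independent_sub I S : I \subset S -> independent S -> independent I.
Proof.
move=> /subsetP IS /independentP indS; apply/independentP => x y xI yI.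
by apply: indS; exact: IS.
Qed.

Lemma independent0 : independent (set0 : {set G}).
Proof. by apply/independentP => x y; rewrite inE. Qed.

Lemma independent1 v : independent [set v].
Proof.
by apply/independentP => x y; rewrite !inE => /eqP -> /eqP ->; rewrite adj_irr.
Qed.

Lemma independent_nbrs S v : triangle_free G -> independent (nbrs S v).
Proof.
move=> tf; apply/independentP => x y; rewrite !inE => /andP[_ vx] /andP[_ vy].
by apply/negP => xy; exact: (tf v x y).
Qed.

Lemma degreeE S v : degree S v = \sum_(y in S) adj v y.
Proof.
rewrite /degree -sum1_card big_mkcond [RHS]big_mkcond /=.
by apply: eq_bigr => y _; rewrite inE; case: (y \in S); case: (adj v y).
Qed.

Lemma degree_sum_monotone S D : D \subset S -> degree_sum D <= degree_sum S.
Proof.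
move=> DS; rewrite /degree_sum [leqRHS](big_setID D) /= (setIidPr DS).
apply: leq_trans (leq_addr _ _); apply: leq_sum => v _; apply: subset_leq_card.
apply/subsetP => y; rewrite !inE => /andP[yD ->].
by rewrite (subsetP DS).
Qed.

(** No edge lies inside [D], so each lost edge has exactly one end in [D]; the degree sum counts it
    twice. *)
Lemma degree_sum_setD S D : D \subset S -> independent D ->
  degree_sum S = degree_sum (S :\: D) + 2 * \sum_(w in D) degree S w.
Proof.
move=> DS /independentP indD.
rewrite /degree_sum (big_setID D) /= (setIidPr DS) addnC mul2n -addnn addnA.
congr (_ + _).
have -> : \sum_(w in D) degree S w = \sum_(v in S :\: D) \sum_(w in D) adj v w.
  rewrite exchange_big /=; apply: eq_bigr => w wD.
  rewrite degreeE (big_setID D) /= (setIidPr DS) big1 ?add0n.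
    by apply: eq_bigr => y _; rewrite adj_sym.
  by move=> y yD; rewrite (negbTE (indD _ _ _ _)).
rewrite -big_split /=; apply: eq_bigr => v _.
by rewrite !degreeE (big_setID D) /= (setIidPr DS) addnC.
Qed.

(** Each [w] contributes its degree once for every neighbour it has. *)
Lemma sum_nbrs_degree S :
  \sum_(v in S) \sum_(w in nbrs S v) degree S w = \sum_(w in S) degree S w ^ 2.
Proof.
rewrite (exchange_big_dep (mem S)) /=; last first.
  by move=> v w _; rewrite inE => /andP[].
apply: eq_bigr => w wS; rewrite sum_nat_const -mulnn; congr (_ * _).
by apply: eq_card => v; rewrite [in LHS]unfold_in !inE wS /= adj_sym.
Qed.

(** The first family consists of the independent sets avoiding [v]; adding [v] injects the second
    into those containing [v]. *)
Lemma num_indep_in_del S v : v \in S ->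
  num_indep_in (S :\ v) + num_indep_in (S :\: (v |: nbrs S v)) <= num_indep_in S.
Proof.
move=> vS; set N := nbrs S v.
pose X := [set I : {set G} | (I \subset S :\ v) && independent I].
pose Y := [set I : {set G} | (I \subset S :\: (v |: N)) && independent I].
have inj : {in Y &, injective (fun I => v |: I)}.
  have vN I : I \in Y -> v \notin I.
    by rewrite inE => /andP[/subsetP IS _]; apply/negP => /IS; rewrite !inE eqxx.
  by move=> I J /vN vI /vN vJ /= eqIJ; rewrite -(setU1K vI) eqIJ setU1K.
have dis : X :&: [set v |: I | I in Y] = set0.
  apply/setP => I; rewrite !inE; apply/negbTE/negP.
  move=> /andP[/andP[/subsetP IS _] /imsetP[J _ eqI]].
  by have := IS v; rewrite eqI !inE eqxx => /(_ isT).
rewrite /num_indep_in -/X -/Y -(card_in_imset inj) -cardsUI dis cards0 addn0.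
apply: subset_leq_card; apply/subsetP => I; rewrite !inE.
case/orP => [/andP[IS ->]|/imsetP[J]].
  by rewrite andbT; apply: subset_trans IS (subsetDl _ _).
rewrite inE => /andP[/subsetP JS /independentP indJ] ->; apply/andP; split.
  apply/subsetP => x; rewrite !inE => /orP[/eqP -> //|/JS].
  by rewrite !inE => /andP[].
have nv x : x \in J -> ~~ adj v x.
  by move=> /JS; rewrite !inE negb_or => /andP[/andP[_ +] xS]; rewrite xS.
apply/independentP => x y; rewrite !inE => /orP[/eqP ->|xJ] /orP[/eqP ->|yJ].
- by rewrite adj_irr.
- exact: nv.
- by rewrite adj_sym; exact: nv.
- exact: indJ.
Qed.

(** Ordered adjacent pairs are grouped by the edge they span; irreflexivity gives exactly two per
    edge. *)
Lemma degree_sumT : degree_sum [set: G] = 2 * #|edges G|.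
Proof.
pose P := [set p : G * G | adj p.1 p.2].
have -> : degree_sum [set: G] = #|P|.
  rewrite /degree_sum -sum1_card.
  under eq_bigr do rewrite degreeE.
  rewrite pair_big /= [RHS]big_mkcond /= big_mkcond /=.
  by apply: eq_bigr => -[x y] _; rewrite !inE /=; case: adj.
have sub : {in P, forall p, [set p.1; p.2] \in edges G}.
  by move=> [x y]; rewrite inE /= => xy; apply/imset2P; exists x y; rewrite ?inE.
rewrite -sum1_card (partition_big (fun p => [set p.1; p.2]) (mem (edges G))) //=.
rewrite mulnC -sum_nat_const; apply: eq_bigr => E /imset2P[x y _].
rewrite inE /= => /andP[_ xy] ->; rewrite sum1_card.
have nxy : x != y by apply: contraTneq xy => ->; rewrite adj_irr.
rewrite (_ : 2 = #|[set (x, y); (y, x)]|); last first.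
  by rewrite cards2 xpair_eqE negb_and nxy.
apply: eq_card => -[a b]; rewrite !inE /= unfold_in /= inE /= !xpair_eqE.
apply/andP/orP.
  move=> [ab /eqP/setP eqab].
  have := eqab a; have := eqab b; rewrite !inE !eqxx orbT /= => /esym hb /esym ha.
  case/orP: ha ab => /eqP ->; case/orP: hb => /eqP ->;
    rewrite ?adj_irr // !eqxx /=; by [left|right].
case=> /andP[/eqP -> /eqP ->]; split; rewrite // ?(adj_sym y) // ?eqxx //.
by rewrite setUC.
Qed.

Lemma exp2_degree_le_num_indep v : triangle_free G ->
  2 ^ degree [set: G] v <= num_indep G.
Proof.
move=> tf; rewrite /degree -card_powerset; apply: subset_leq_card.
apply/subsetP => I; rewrite !inE => sub.
exact: independent_sub sub (independent_nbrs _ _ tf).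
Qed.

End InducedSubgraphs.

(** * The induction on vertex sets *)

Section Counting.
Import fintype boot.finset.
Context {R : realType} {G : sgraph}.
Implicit Types (S : {set G}) (u : R).

(** Cauchy-Schwarz, read off from the nonnegative sum of squared deviations from the mean degree. *)
Lemma sqr_degree_sum S :
  ((degree_sum S)%:R : R) ^+ 2 <= #|S|%:R * (\sum_(w in S) degree S w ^ 2)%:R.
Proof.
have [->|S0] := eqVneq S set0.
  by rewrite /degree_sum !big_set0 cards0 mul0r expr0n.
have n0 : 0 < #|S|%:R :> R by rewrite ltr0n card_gt0.
pose d w : R := (degree S w)%:R; pose t := (\sum_(w in S) d w) / #|S|%:R.
have -> : (degree_sum S)%:R = \sum_(w in S) d w by rewrite natr_sum.
have -> : (\sum_(w in S) degree S w ^ 2)%:R = \sum_(w in S) d w ^+ 2.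
  by rewrite natr_sum; apply: eq_bigr => w _; rewrite natrX.
have : 0 <= \sum_(w in S) (d w - t) ^+ 2.
  by apply: sumr_ge0 => w _; exact: sqr_ge0.
have -> : \sum_(w in S) (d w - t) ^+ 2 =
    \sum_(w in S) d w ^+ 2 - 2 * t * (\sum_(w in S) d w) + #|S|%:R * t ^+ 2.
  rewrite mulr_sumr (mulr_natl _ #|S|) -sumr_const -sumrB -big_split /=.
  by apply: eq_bigr => w _; ring.
rewrite -(ler_pM2l n0) mulr0 -[_ ^+ 2 <= _]subr_ge0.
congr (is_true (0 <= _)); rewrite /t.
by field; rewrite gt_eqF.
Qed.

(** Quantifying over all tangents keeps the exponent linear in the vertex count and the degree sum,
    and lets the induction hypothesis be used on both smaller sets with the tangent chosen for
    [S]. *)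
Lemma expR_le_num_indep_in S u : triangle_free G -> 3 <= u ->
  expR (#|S|%:R * line_cst u + (degree_sum S)%:R * line_slope u)
  <= (num_indep_in S)%:R.
Proof.
move=> tf; have [k] := ubnP #|S|.
elim: k => // k IH in S u *; rewrite ltnS => Sk u3.
have [->|S0] := eqVneq S set0.
  rewrite /degree_sum big_set0 cards0 !mul0r addr0 expR0 ler1n.
  by apply/card_gt0P; exists set0; rewrite inE sub0set independent0.
have n0 : 0 < #|S|%:R :> R by rewrite ltr0n card_gt0.
pose t : R := (degree_sum S)%:R / #|S|%:R.
have nt : #|S|%:R * t = (degree_sum S)%:R by rewrite mulrC divfK // gt_eqF.
have t0 : 0 <= t by rewrite divr_ge0.
have [v [v3 vmax step]] := max_line t0.
have lineE w : #|S|%:R * line_cst w + (degree_sum S)%:R * line_slope w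
               = #|S|%:R * line t w.
  by rewrite -nt /line; ring.
(* Pass to the tangent that is highest at the average degree [t] of [S]. *)
rewrite lineE; apply: (@le_trans _ _ (expR (#|S|%:R * line t v))).
  by rewrite ler_expR ler_pM2l // vmax.
rewrite -lineE; set M := _ + _.
set A := line_cst v in step M *; set B := line_slope v in step M *.
have B0 : B <= 0 by apply: line_slope_le0; lra.
pose s x : R := (\sum_(w in nbrs S x) degree S w)%:R.
have del1 x : x \in S ->
    expR M * expR (- A - 2 * (degree S x)%:R * B) <= (num_indep_in (S :\ x))%:R.
  move=> xS; rewrite -expRD.
  have cS := cardsD1 x S; rewrite xS add1n in cS.
  apply: le_trans (IH (S :\ x) v _ v3); last by rewrite -cS.
  rewrite ler_expR -/A -/B /M.
  have sub : [set x] \subset S by rewrite sub1set.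
  rewrite (degree_sum_setD sub (independent1 x)) big_set1 cS.
  by rewrite natrD natrM -natr1; lra.
have del2 x : x \in S ->
    expR M * expR (- (1 + (degree S x)%:R) * A - 2 * s x * B)
    <= (num_indep_in (S :\: (x |: nbrs S x)))%:R.
  move=> xS; rewrite -expRD.
  have sub : nbrs S x \subset S by apply/subsetP => y; rewrite inE => /andP[].
  have xN : x \notin nbrs S x by rewrite inE adj_irr andbF.
  have cN : #|x |: nbrs S x| = (degree S x).+1 by rewrite cardsU1 xN.
  have subx : x |: nbrs S x \subset S by rewrite subUset sub1set xS.
  have cS : #|S| = (#|S :\: (x |: nbrs S x)| + (degree S x).+1)%N.
    by rewrite -(cardsID (x |: nbrs S x) S) (setIidPr subx) cN addnC.
  apply: le_trans (IH (S :\: (x |: nbrs S x)) v _ v3).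
    (* The loss is computed for the independent set [nbrs S x] alone; removing [x] too cannot raise
       the degree sum, and [B <= 0]. *)
    rewrite ler_expR -/A -/B /M (degree_sum_setD sub (independent_nbrs _ _ tf)).
    have mono : (degree_sum (S :\: (x |: nbrs S x))
                 <= degree_sum (S :\: nbrs S x))%N.
      by apply: degree_sum_monotone; apply: setDS; exact: subsetUr.
    rewrite cS 2!natrD natrM -/(s x) -natr1.
    rewrite -(ler_nat R) in mono; have := ler_wnM2r B0 mono; lra.
  by rewrite cS addnS in Sk; exact: leq_ltn_trans (leq_addr _ _) Sk.
(* Average over all [x] in [S] instead of choosing one. *)
rewrite -(ler_pM2l n0); apply: (@le_trans _ _ (\sum_(x in S)
    expR M * (expR (- A - 2 * (degree S x)%:R * B)
              + expR (- (1 + (degree S x)%:R) * A - 2 * s x * B)))); last first.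
  rewrite mulr_natl -sumr_const; apply: ler_sum => x xS.
  rewrite mulrDr; apply: le_trans (lerD (del1 x xS) (del2 x xS)) _.
  by rewrite -natrD ler_nat num_indep_in_del.
rewrite -mulr_sumr mulrC ler_pM2l ?expR_gt0 // big_split /=.
have sum_deg : \sum_(x in S) (degree S x)%:R = #|S|%:R * t :> R.
  by rewrite nt -natr_sum.
have sum_s : \sum_(x in S) s x >= #|S|%:R * t ^+ 2.
  rewrite -natr_sum sum_nbrs_degree -(ler_pM2l n0).
  apply: le_trans (sqr_degree_sum S); rewrite -nt; lra.
have sumA (c : R) : \sum_(x in S) c = #|S|%:R * c by rewrite sumr_const mulr_natl.
apply: le_trans (lerD (sum_expR_ge (m := - A - 2 * t * B) _)
                      (sum_expR_ge (m := - (1 + t) * A - 2 * t ^+ 2 * B) _)).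
- by rewrite -mulrDr ler_peMr // ltW.
- rewrite big_split /= sumA sumrN -mulr_suml -mulr_sumr sum_deg; lra.
- rewrite big_split /= -mulr_suml sumrN big_split /= sumA sum_deg.
  rewrite sumrN -mulr_suml -mulr_sumr.
  have := ler_wnM2r B0 sum_s; lra.
Qed.

(** * Passage to the whole graph and its average degree *)

Lemma num_indep_gt0 : (0 < num_indep G)%N.
Proof. by apply/card_gt0P; exists set0; rewrite inE independent0. Qed.

Lemma avg_degree_card0 : #|G| = 0%N -> avg_degree R G = 0.
Proof. by move=> n0; rewrite /avg_degree n0 invr0 mulr0. Qed.

Lemma avg_degreeE : #|G|%:R * avg_degree R G = (degree_sum [set: G])%:R.
Proof.
have [n0|n0] := posnP #|G|.
  rewrite n0 mul0r /degree_sum big1 // => x _.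
  by have := card0_eq n0 x; rewrite inE.
rewrite degree_sumT natrM /avg_degree mulrC divfK //.
by rewrite pnatr_eq0 -lt0n.
Qed.

Lemma expR_line_le_num_indep u : triangle_free G -> 3 <= u ->
  expR (#|G|%:R * line (avg_degree R G) u) <= (num_indep G)%:R.
Proof.
move=> tf u3; have := expR_le_num_indep_in [set: G] tf u3.
by rewrite num_indep_inT cardsT -avg_degreeE /line mulrDr mulrA.
Qed.

Lemma powR_avg_degree_le_num_indep : triangle_free G ->
  2 `^ avg_degree R G <= (num_indep G)%:R.
Proof.
move=> tf; have [n0|n0] := posnP #|G|.
  by rewrite avg_degree_card0 // powRr0 ler1n num_indep_gt0.
have [v0 _] := card_gt0P n0.
pose v := [arg max_(x > v0) degree [set: G] x].
apply: (@le_trans _ _ (2 `^ (degree [set: G] v)%:R)); last first.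
  by rewrite powR_mulrn // -natrX ler_nat exp2_degree_le_num_indep.
apply: ler_powR; first by lra.
rewrite -(ler_pM2l (_ : 0 < #|G|%:R)) ?ltr0n // avg_degreeE -natrM ler_nat.
rewrite -cardsT -sum_nat_const; apply: leq_sum => x _.
by rewrite /v; case: arg_maxnP => // i _; exact.
Qed.

End Counting.

Lemma expR_avg_degree_le_num_indep (R : realType) (G : sgraph) (c : R) :
  triangle_free G -> 1 <= avg_degree R G -> 0 <= c <= 1 ->
  expR (c * (1 / 2) * (#|G|%:R / avg_degree R G) * ln (avg_degree R G)
        * (1 / 2 * ln (avg_degree R G) - 1)) <= (num_indep G)%:R.
Proof.
move=> tf t1 /andP[c0 c1]; set t := avg_degree R G in t1 *; set n : R := #|G|%:R.
have t0 : 0 < t by lra.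
have n0 : 0 <= n by exact: ler0n.
have w0 : 0 <= ln t by exact: ln_ge0.
have tE : expR (ln t) = t by rewrite lnK.
have -> : c * (1 / 2) * (n / t) * ln t * (1 / 2 * ln t - 1)
        = c * (n * ((ln t ^+ 2 - 2 * ln t) / 4 / t)).
  by field; rewrite gt_eqF.
have [w2|w2] := leP (ln t) 2.
  apply: (@le_trans _ _ 1); last by rewrite ler1n num_indep_gt0.
  rewrite expR_le1; apply: mulr_ge0_le0 => //; apply: mulr_ge0_le0 => //.
  apply: mulr_le0_ge0; last by rewrite invr_ge0 ltW.
  by nra.
apply: (@le_trans _ _ (expR (n * line t (Num.max 3 (ln t))))); last first.
  by apply: expR_line_le_num_indep; rewrite // le_max lexx.
rewrite ler_expR; set p := _ / 4 / t.
have p0 : 0 <= p.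
  by rewrite divr_ge0 ?(ltW t0) //; nra.
suff pl : p <= line t (Num.max 3 (ln t)).
  apply: (@le_trans _ _ (1 * (n * p))); first by rewrite ler_wpM2r // mulr_ge0.
  by rewrite mul1r ler_wpM2l.
have [w3|w3] := leP (ln t) 3.
  (* The tangent at [expR 3] is nonincreasing, so its value at [t] is at least that at [expR 3];
     then [ln t - 2 <= expR (ln t - 3)] suffices. *)
  have te : t <= expR 3 by rewrite -tE ler_expR.
  apply: (@le_trans _ _ (line (expR 3) 3)); last first.
    by rewrite lerD2l ler_wnM2r // line_slope_le0 //; lra.
  rewrite line_expR.
  have e0 := expR_gt0 (3 : R).
  have w23 : ln t - 2 <= t / expR 3.
    by rewrite -{2}tE -expRB; apply: le_trans (expR_ge1Dx _); lra.
  have -> : 3 ^+ 2 / 4 / expR 3 = 9 / 4 * (t / expR 3) / t.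
    by field; rewrite !gt_eqF.
  have : 0 <= t / expR 3 by rewrite divr_ge0 // ltW.
  by rewrite /p ler_pM2r ?invr_gt0 //; nra.
by rewrite -{1}tE line_expR tE /p ler_pM2r ?invr_gt0 //; lra.
Qed.

Theorem theorem1 (R : realType) :
  (forall G : sgraph, triangle_free G ->
     let n : R := #|G|%:R in
     let t : R := avg_degree R G in
     (1 <= t ->
        Num.max
          (expR ((1 - n `^ (- (1 / 12))) * (1 / 2) * (n / t) * ln t
                   * (1 / 2 * ln t - 1)))
          (2 `^ t)
        <= (num_indep G)%:R)
     /\ 2 `^ t <= (num_indep G)%:R)
  /\
  (exists delta : nat -> R,
     (delta @ \oo --> (0 : R)) /\
     forall H : sgraph, triangle_free H ->
       expR ((1 - delta #|H|)
               * (Num.sqrt (#|H|%:R * ln 2) * ln #|H|%:R / 4))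
       <= (num_indep H)%:R).
Proof.
split=> [G tf n t|].
  split=> [t1|]; last exact: powR_avg_degree_le_num_indep.
  rewrite ge_max powR_avg_degree_le_num_indep // andbT.
  apply: expR_avg_degree_le_num_indep => //.
  have n1 : 1 <= n.
    rewrite ler1n lt0n; apply: contraTneq t1 => /(@avg_degree_card0 R).
    by rewrite -/t => ->; rewrite ler10.
  rewrite subr_ge0 gerBl powR_ge0 andbT -[leRHS](powRr0 n).
  by apply: ler_powR => //; lra.
(* The threshold 6 gives [ln n / 2 >= 3], hence an admissible tangent, and
   [ln n ^+ 2 >= 36 > 16 * ln 2]. Below it the claim reduces to [1 <= i(H)]. *)
exists (fun n => if 6 <= ln (n%:R : R) then 0 else 1); split.
  apply: cvg_near_cst; near=> n; rewrite ifT //.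
  have n6 : expR 6 <= n%:R :> R by near: n; exact: nbhs_infty_ger.
  by rewrite -(expRK 6) ler_ln ?posrE ?expR_gt0 // (lt_le_trans _ n6) ?expR_gt0.
move=> H tf; set n : R := #|H|%:R; set t := avg_degree R H.
case: ifP => [n6|_]; last first.
  by rewrite subrr mul0r expR0 ler1n num_indep_gt0.
rewrite subr0 mul1r.
have n0 : 0 < n.
  by rewrite ltNge; apply/negP => n0; have := @ln_le0 _ n; lra.
have l2 : 0 < ln 2 :> R by rewrite ln_gt0 //; lra.
set s := Num.sqrt (n * ln 2).
have s0 : 0 < s by rewrite sqrtr_gt0 mulr_gt0.
have s2 : s ^+ 2 = n * ln 2 by rewrite sqr_sqrtr // ltW // mulr_gt0.
(* [T] is chosen so that [2]^ T[equals the target; hence]t >= T[is settled by the bound]2 [^ t]. *)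
pose T := s * ln n / 4 / ln 2.
have T0 : 0 < T by rewrite !divr_gt0 // mulr_gt0 //; lra.
have [tT|tT] := leP T t.
  apply: le_trans (powR_avg_degree_le_num_indep tf).
  rewrite /powR ifF; last by apply/negbTE; lra.
  by rewrite ler_expR -ler_pdivrMr.
have TE : expR (ln T) = T by rewrite lnK.
have lT : ln n / 2 <= ln T.
  have nT : n <= T ^+ 2.
    rewrite /T !expr_div_n exprMn s2.
    have -> : n * ln 2 * ln n ^+ 2 / 4 ^+ 2 / ln 2 ^+ 2
            = n * (ln n ^+ 2 / 16 / ln 2).
      by field; rewrite gt_eqF.
    rewrite -[leLHS]mulr1 ler_pM2l // ler_pdivlMr // mul1r.
    by have := @ln_sublinear R 2; nra.
  by rewrite -ler_ln ?posrE ?exprn_gt0 // lnXn // mulr2n in nT; lra.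
apply: le_trans (expR_line_le_num_indep (u := ln T) tf _); last by lra.
(* For [t < T], even [t < 1], the nonincreasing tangent at [T] is at least its value at [T]. *)
rewrite ler_expR; apply: (@le_trans _ _ (n * line T (ln T))); last first.
  rewrite ler_pM2l // lerD2l ler_wnM2r // ?line_slope_le0 //; [lra|exact: ltW].
rewrite -{1}TE line_expR TE.
rewrite mulrA ler_pdivlMr //.
have -> : s * ln n / 4 * T = s ^+ 2 / ln 2 * (ln n / 2) ^+ 2 / 4.
  by rewrite /T; field; rewrite gt_eqF.
have sq : (ln n / 2) ^+ 2 <= ln T ^+ 2 by rewrite lerXn2r // nnegrE; lra.
by rewrite s2 mulfK ?gt_eqF //; rewrite -(ler_pM2l n0) in sq; lra.
Unshelve. all: by end_near.
Qed.
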